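(* Let $N$ be an $n$-dimensional proper slant submanifold of ${\bf C}^n$. Then the canonical $1$-form $\Theta$ on $N$ is closed, that is, $d\Theta=0$. Hence $\Theta$ defines a canonical cohomology class on $N$: $[\Theta]\in H^1(N;{\bf R})$.
   Context: ${\bf C}^n$ has its standard flat Kaehler structure with complex structure $J$; $n$ is the real dimension of $N$. $N$ is slant if, for nonzero $X\in T_xN$, the angle between $JX$ and $T_xN$ is a constant $\alpha$ independent of $x\in N$ and of $X$; proper slant if $\alpha\neq0,\pi/2$. In this case $n=2k$ is even. For $X$ tangent to $N$ write $JX=PX+FX$ with $PX$ tangent, $FX$ normal. An adapted slant frame is a local orthonormal frame $e_1,\dots,e_n,e_{1^*},\dots,e_{n^*}$ along $N$ with $e_1,\dots,e_n$ tangent to $N$, $e_{2j}=(\sec\alpha)Pe_{2j-1}$ for $j=1,\dots,k$, and $e_{i^*}=(\csc\alpha)Fe_i$ for $i=1,\dots,n$. With connection forms $\omega_i^{j^*}(X)=\langle\tilde\nabla_Xe_i,e_{j^*}\rangle$ ($\tilde\nabla$ the flat connection of ${\bf C}^n$), the canonical $1$-form is $\Theta=\sum_{i=1}^n\omega_i^{i^*}$; equivalently $\Theta(X)=(\csc\alpha)\sum_{i=1}^n\langle h(X,e_i),Fe_i\rangle$, with $h$ the second fundamental form, which is independent of the choice of orthonormal tangent frame. *)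

(* Defs.v *)
(* Mathematical Components + MathComp-Analysis *)
From HB Require Import structures.
From mathcomp Require Import all_boot all_order all_algebra.
From mathcomp Require Import all_classical all_reals all_analysis.

Set Implicit Arguments.
Unset Strict Implicit.
Unset Printing Implicit Defensive.

Import Order.TTheory GRing.Theory Num.Theory.
Import numFieldNormedType.Exports.

Local Open Scope classical_set_scope.
Local Open Scope ring_scope.

Section Smooth.
Context {R : realType} {n : nat} {V : normedModType R}.

(* [U] is meant to be open. *)
Fixpoint Ck_on (k : nat) (U : set 'rV[R]_n) (f : 'rV[R]_n -> V) : Prop :=
  match k with
  | 0 => forall u, U u -> {for u, continuous f}
  | k'.+1 => (forall u, U u -> differentiable f u) /\
             (forall v, Ck_on k' U (fun u => 'D_v f u))
  end.

Definition smooth_on (U : set 'rV[R]_n) (f : 'rV[R]_n -> V) : Prop :=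
  forall k, Ck_on k U f.

End Smooth.

(* Smooth n-manifolds without boundary: [coord a] is a homeomorphism, with
   inverse [param a], from the open set [cdom a] onto an open subset of R^n. *)
Record smooth_manifold (R : realType) (n : nat) := SmoothManifold {
  carrier :> topologicalType;
  atlas : Type;
  cdom : atlas -> set carrier;
  coord : atlas -> carrier -> 'rV[R]_n;
  param : atlas -> 'rV[R]_n -> carrier;
  manifold_hausdorff : hausdorff_space carrier;
  manifold_second_countable : @second_countable carrier;
  atlas_cover : forall x, exists a, cdom a x;
  cdom_open : forall a, open (cdom a);
  coord_open : forall a, open (coord a @` cdom a);
  coordK : forall a x, cdom a x -> param a (coord a x) = x;
  coord_continuous : forall a x, cdom a x -> {for x, continuous (coord a)};
  param_continuous : forall a u, (coord a @` cdom a) u ->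
    {for u, continuous (param a)};
  transition_smooth : forall a b,
    smooth_on ((coord a @` cdom a) `&` (param a @^-1` cdom b))
              (fun u => coord b (param a u))
}.

Section Manifold.
Context {R : realType} {n : nat} (N : smooth_manifold R n).

Definition crange (a : atlas N) : set 'rV[R]_n := coord a @` cdom a.

Definition smooth_along {V : normedModType R} (W : set N) (g : N -> V) : Prop :=
  forall a, smooth_on (crange a `&` (param a @^-1` W)) (g \o param a).

(* A field of covectors in coordinates: [t a u] is the column of components, at
   the point of coordinates [u] in the chart [a]; values of [t a] outside
   [crange a] are irrelevant. *)
Definition covector_field := atlas N -> 'rV[R]_n -> 'cV[R]_n.

Definition ev (t : covector_field) (a : atlas N) (u xi : 'rV[R]_n) : R :=
  (xi *m t a u) 0 0.

Definition one_form (t : covector_field) : Prop :=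
  (forall a, smooth_on (crange a) (t a)) /\
  (forall a b u, crange a u -> cdom b (param a u) -> forall xi,
     ev t a u xi =
     ev t b (coord b (param a u)) (xi *m jacobian (coord b \o param a) u)).

(* dt(xi, eta) in the chart [a], for the fields of constant components xi, eta
   (which commute). *)
Definition ext_d (t : covector_field) (a : atlas N) (u xi eta : 'rV[R]_n) : R :=
  'D_xi (fun v => ev t a v eta : R^o) u - 'D_eta (fun v => ev t a v xi : R^o) u.

Definition closed_form (t : covector_field) : Prop :=
  one_form t /\
  forall a u, crange a u -> forall xi eta, ext_d t a u xi eta = 0.

Definition exact_form (t : covector_field) : Prop :=
  exists f : N -> R^o, smooth_along setT f /\
    forall a u, crange a u -> forall xi, ev t a u xi = 'D_xi (f \o param a) u.

Definition cohomology_class (t : covector_field) : set covector_field :=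
  [set s | closed_form s /\ exact_form (fun a u => s a u - t a u)].

(* H^1(N; R), as de Rham cohomology: the quotient set of the closed 1-forms by
   the relation "the difference is exact". *)
Definition H1 : set (set covector_field) :=
  [set cohomology_class t | t in [set t | closed_form t]].

End Manifold.

Section Euclidean.
Context {R : realType}.

Definition dot {m} (v w : 'rV[R]_m) : R := (v *m w^T) 0 0.

Definition enorm {m} (v : 'rV[R]_m) : R := Num.sqrt (dot v v).

(* Orthogonal projection onto the row space of [T]; the rows of [kermx T^T]
   span its orthogonal complement. *)
Definition oproj {p m} (T : 'M[R]_(p, m)) (v : 'rV[R]_m) : 'rV[R]_m :=
  v *m proj_mx <<T>>%MS (kermx T^T).

Definition angle_subspace {p m} (v : 'rV[R]_m) (T : 'M[R]_(p, m)) : R :=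
  acos (enorm (oproj T v) / enorm v).

(* C^n is R^n x R^n, (x, y) standing for x + i y; this is multiplication by i. *)
Definition Jc {n} (v : 'rV[R]_(n + n)) : 'rV[R]_(n + n) :=
  row_mx (- rsubmx v) (lsubmx v).

Definition tanP {p n} (T : 'M[R]_(p, n + n)) (v : 'rV[R]_(n + n)) :=
  oproj T (Jc v).

Definition norF {p n} (T : 'M[R]_(p, n + n)) (v : 'rV[R]_(n + n)) :=
  Jc v - tanP T v.

End Euclidean.

Section Submanifold.
Context {R : realType} {n : nat} (N : smooth_manifold R n).

(* The rows are the coordinate tangent vectors; their span is the tangent space
   of the submanifold, as a subspace of R^m. *)
Definition tspace {m} (phi : N -> 'rV[R]_m) (a : atlas N) (u : 'rV[R]_n) :
  'M[R]_(n, m) := jacobian (phi \o param a) u.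

Definition immersion {m} (phi : N -> 'rV[R]_m) : Prop :=
  smooth_along setT phi /\
  forall a u, crange a u -> row_free (tspace phi a u).

Variable phi : N -> 'rV[R]_(n + n).

Definition slant (alpha : R) : Prop :=
  forall a u, crange a u -> forall X : 'rV[R]_(n + n),
    (X <= tspace phi a u)%MS -> X != 0 ->
    angle_subspace (Jc X) (tspace phi a u) = alpha.

Definition proper_slant (alpha : R) : Prop :=
  [/\ slant alpha, alpha != 0 & alpha != pi / 2].

(* h(X, Y) is the normal part of the flat derivative along X of a tangent
   extension of Y; here xi and eta are the components of X and Y in the chart
   [a], and Y is extended with constant components. *)
Definition second_ff (a : atlas N) (u xi eta : 'rV[R]_n) : 'rV[R]_(n + n) :=
  let D := 'D_xi (fun v => 'D_eta (phi \o param a) v) u in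
  D - oproj (tspace phi a u) D.

(* The rows of E are the components in the chart [a] of an orthonormal basis of
   the tangent space. *)
Definition orthonormal_basis (a : atlas N) (u : 'rV[R]_n) (E : 'M[R]_n) : Prop :=
  (E *m tspace phi a u) *m (E *m tspace phi a u)^T = 1%:M.

(* Theta(X) = csc alpha * sum_i <h(X, e_i), F e_i>.  The sum does not depend on
   the orthonormal basis (e_i), so any one can be chosen. *)
Definition canonical_form (alpha : R) : covector_field N := fun a u =>
  let E := xget 0 [set E | orthonormal_basis a u E] in
  let T := tspace phi a u in
  \col_j ((sin alpha)^-1 *
    \sum_i dot (second_ff a u (delta_mx 0 j) (row i E)) (norF T (row i E *m T))).

(* e i and es i are the vectors e_{i+1} and e_{(i+1)^*} (indices from 0). *)
Definition adapted_slant_frame (alpha : R) (W : set N)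
    (e es : 'I_n -> N -> 'rV[R]_(n + n)) : Prop :=
  [/\ open W,
      forall i, smooth_along W (e i) /\ smooth_along W (es i),
      forall x, W x -> forall i j,
        [/\ dot (e i x) (e j x) = (i == j)%:R,
            dot (es i x) (es j x) = (i == j)%:R
          & dot (e i x) (es j x) = 0]
    & forall a u, crange a u -> W (param a u) ->
        let x := param a u in let T := tspace phi a u in
        [/\ forall i, (e i x <= T)%MS,
            forall i j : 'I_n, ~~ odd i -> j = i.+1 :> nat ->
              e j x = (cos alpha)^-1 *: tanP T (e i x)
          & forall i, es i x = (sin alpha)^-1 *: norF T (e i x)]].

(* omega_i^{j^*}(X), X being the tangent vector of components xi. *)
Definition connection_form (e es : 'I_n -> N -> 'rV[R]_(n + n)) (i j : 'I_n)
    (a : atlas N) (u xi : 'rV[R]_n) : R :=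
  dot ('D_xi (e i \o param a) u) (es j (param a u)).

End Submanifold.

(* Main.v *)
(* In a chart let T be the Jacobian of the immersion: its rows are the
   coordinate tangent vectors. Being slant with alpha <> 0 makes these rows
   linearly independent over C, since the rows F(T_k) of the normal parts of
   J T_k have Gram matrix sin^2(alpha) g. Expanding the second derivatives
   D T_k = sum_l (a_kl T_l + b_kl J T_l) and pairing with F(T_l) gives
   Theta = sin(alpha) * tr b, that is, sin(alpha) times the differential of the
   argument of the complex determinant of T. So Theta is smooth, does not depend
   on the chart, and is closed because second derivatives commute. *)
Require Import Defs.
From HB Require Import structures.
From mathcomp Require Import all_boot all_order all_algebra.
From mathcomp Require Import all_classical all_reals all_analysis.
From mathcomp Require Import ring lra.

Set Implicit Arguments.
Unset Strict Implicit.
Unset Printing Implicit Defensive.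

Import Order.TTheory GRing.Theory Num.Theory.
Import numFieldNormedType.Exports.

Local Open Scope classical_set_scope.
Local Open Scope ring_scope.

(** * Differentiability and smoothness of matrix-valued maps *)

Section MatrixCalculus.
Context {R : realType}.

(** At each point [canonical_form] takes whatever orthonormal basis [xget] returns, with no
    regularity in the point, so it cannot be differentiated as it stands. Every such basis [E]
    satisfies E^T E = g^-1, where g is the Gram matrix of T, so the sum over the basis is a trace
    from which [E] disappears. The Gram matrix of the F(T_k) contributes sin^2(alpha), of which
    csc(alpha) leaves sin(alpha), a constant that passes through every derivative. Complex linear
    algebra is done over the reals with the square matrix M = [T; T J]: X M^-1 = [A B] means X = (A
    + iB) T, so tr b is the trace of a right half. The argument, defined only locally and modulo 2
    pi, is never formed. Differentiating tr b directly gives a term in the second derivatives of T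
    and, from the derivative of M^-1, a term quadratic in DT; the latter is symmetric because the
    trace of a product of two complex matrices does not depend on their order. A change of chart
    multiplies T by a real matrix, hence the complex determinant by a real factor, which leaves the
    differential of its argument unchanged. *)

Lemma mx_linear_differentiable {p q} {W : normedModType R}
    (L : {linear 'M[R]_(p, q) -> W}) (A : 'M[R]_(p, q)) : differentiable L A.
Proof.
have -> : (L : 'M[R]_(p, q) -> W) =
    \sum_(i < p) \sum_(j < q) (fun B : 'M[R]_(p, q) => B i j *: L (delta_mx i j)).
  apply/funext => B; rewrite fct_sumE [in LHS](matrix_sum_delta B) linear_sum.
  apply: eq_bigr => i _; rewrite fct_sumE linear_sum.
  by apply: eq_bigr => j _; rewrite linearZ.
apply: differentiable_sum => i; apply: differentiable_sum => j.
exact/differentiableZl/differentiable_coord.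
Qed.

Lemma mx_linear_continuous {p q} {W : normedModType R}
    (L : {linear 'M[R]_(p, q) -> W}) : continuous L.
Proof. by move=> A; exact/differentiable_continuous/mx_linear_differentiable. Qed.

Lemma derive_linear {V W W' : normedModType R} (L : {linear W -> W'})
    (f : V -> W) (u v : V) : continuous L -> differentiable f u ->
  'D_v (L \o f) u = L ('D_v f u).
Proof.
move=> cL df; have dL : differentiable L (f u) by exact: linear_differentiable.
rewrite !deriveE//; last exact: differentiable_comp.
by rewrite diff_comp// diff_lin.
Qed.

Lemma differentiable_mxP {V : normedModType R} {p q} (f : V -> 'M[R]_(p, q)) u :
  differentiable f u <-> forall i j, differentiable (fun v => f v i j) u.
Proof.
split=> [df i j|df].
  exact: (differentiable_comp df (differentiable_coord (f u) i j)).
have -> : f = \sum_(i < p) \sum_(j < q) (fun v => f v i j *: delta_mx i j).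
  apply/funext => v; rewrite [LHS]matrix_sum_delta fct_sumE.
  by apply: eq_bigr => i _; rewrite fct_sumE.
apply: differentiable_sum => i; apply: differentiable_sum => j.
exact: differentiableZl.
Qed.

Lemma derive_mxE {V : normedModType R} {p q} (f : V -> 'M[R]_(p, q)) u v i j :
  differentiable f u -> ('D_v f u) i j = 'D_v (fun x => f x i j) u.
Proof. by move=> df; rewrite derive_mx ?mxE//; exact: diff_derivable. Qed.

Lemma differentiable_mulmx {V : normedModType R} {m p q}
    (f : V -> 'M[R]_(m, p)) (g : V -> 'M[R]_(p, q)) u :
  differentiable f u -> differentiable g u ->
  differentiable (fun v => f v *m g v) u.
Proof.
move=> /differentiable_mxP df /differentiable_mxP dg.
apply/differentiable_mxP => i j.
have -> : (fun v => (f v *m g v) i j) =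
    \sum_(k < p) ((fun v => f v i k) * (fun v => g v k j)).
  by apply/funext => v; rewrite fct_sumE mxE.
by apply: differentiable_sum => k; exact: differentiableM.
Qed.

Lemma derive_mulmx {V : normedModType R} {m p q}
    (f : V -> 'M[R]_(m, p)) (g : V -> 'M[R]_(p, q)) u v :
  differentiable f u -> differentiable g u ->
  'D_v (fun x => f x *m g x) u = 'D_v f u *m g u + f u *m 'D_v g u.
Proof.
move=> df dg; apply/matrixP => i j.
rewrite derive_mxE; last exact: differentiable_mulmx.
have -> : (fun v => (f v *m g v) i j) =
    \sum_(k < p) ((fun v => f v i k) * (fun v => g v k j)).
  by apply/funext => x; rewrite fct_sumE mxE.
have dfc k : derivable (fun v => f v i k) u v.
  by apply: diff_derivable; move/differentiable_mxP : df.
have dgc k : derivable (fun v => g v k j) u v.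
  by apply: diff_derivable; move/differentiable_mxP : dg.
rewrite derive_sum; last by move=> k; exact: derivableM.
rewrite !mxE -big_split; apply: eq_bigr => k _ /=.
by rewrite deriveM// !derive_mxE// addrC; congr (_ + _); rewrite -mulrC.
Qed.

(** The difference [g - f] vanishes near [u], so it is a constant plus the zero map plus a little-o
    term; by uniqueness its differential is 0, and [g] is recovered as [(g - f) + f]. *)
Lemma near_eq_differentiable {V W : normedModType R} (f g : V -> W) u :
  (\near u, f u = g u) -> differentiable f u -> differentiable g u.
Proof.
move=> fg df; suff dh : differentiable (g - f) u.
  by have := differentiableD dh df; rewrite subrK.
have h0 : (g - f) \o shift u = cst ((g - f) u) + (\0 : V -> W) +o_ 0 id.
  apply/eqaddoP; rewrite addr0 => e e0.
  have gfu : g u = f u by rewrite (nbhs_singleton fg).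
  have : \forall x \near (0 : V), f (x + u) = g (x + u).
    by move: fg; rewrite (near_shift 0) subr0.
  apply: filterS => x fgx; rewrite /= /GRing.add /= /GRing.opp /=.
  rewrite -!/(_ - _) gfu subrr [g _](_ : _ = f (x + u)); last by rewrite fgx.
  by rewrite !subrr normr0 mulr_ge0// ltW.
apply/diff_locallyP; rewrite (@diff_unique _ _ _ _ \0 _ _ h0); last first.
  exact: cst_continuous.
by split; [exact: cst_continuous|exact: h0].
Qed.

End MatrixCalculus.

Section Ck.
Context {R : realType} {n : nat} (U : set 'rV[R]_n).
Hypothesis openU : open U.

Lemma near_eq_on {W : Type} (f g : 'rV[R]_n -> W) u :
  {in U, f =1 g} -> U u -> \near u, f u = g u.
Proof.
move=> fg Uu; have := open_nbhs_nbhs (conj openU Uu).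
by apply: filterS => x Ux; apply: fg; rewrite inE.
Qed.

(** Closed formulas for derivatives hold only on [U]. Openness turns equality on [U] into equality
    near each point, which differentiation respects. *)
Lemma Ck_on_ext {V : normedModType R} k (f g : 'rV[R]_n -> V) :
  {in U, f =1 g} -> Ck_on k U f -> Ck_on k U g.
Proof.
elim: k f g => [|k IHk] f g fg /=.
  move=> cf u Uu; have fgu := near_eq_on fg Uu.
  have : f x @[x --> u] --> f u by exact: cf.
  rewrite (nbhs_singleton fgu); apply: cvg_trans.
  exact: (@near_eq_cvg _ _ (nbhs u) _ f g fgu).
move=> [df Df]; split=> [u Uu|v].
  exact: near_eq_differentiable (near_eq_on fg Uu) (df u Uu).
apply: IHk (Df v) => u; rewrite inE => Uu.
by apply: near_eq_derive; exact: near_eq_on.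
Qed.

Lemma Ck_onS {V : normedModType R} k (f : 'rV[R]_n -> V) :
  Ck_on k.+1 U f -> Ck_on k U f.
Proof.
elim: k f => [|k IHk] f [df Df].
  by move=> u Uu; exact/differentiable_continuous/df.
by split=> // v; exact: IHk.
Qed.

Lemma Ck_on_cst {V : normedModType R} k (a : V) : Ck_on k U (cst a).
Proof.
elim: k a => [|k IHk] a /=; first by move=> u _; exact: cst_continuous.
split=> [u _|v]; first exact: differentiable_cst.
by apply: Ck_on_ext (IHk 0) => u _; rewrite derive_cst.
Qed.

Lemma Ck_onD {V : normedModType R} k (f g : 'rV[R]_n -> V) :
  Ck_on k U f -> Ck_on k U g -> Ck_on k U (fun u => f u + g u).
Proof.
elim: k f g => [|k IHk] f g /=.
  by move=> cf cg u Uu; apply: continuousD; [exact: cf|exact: cg].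
move=> [df Df] [dg Dg]; split=> [u Uu|v].
  by apply: differentiableD; [exact: df|exact: dg].
apply: Ck_on_ext (IHk _ _ (Df v) (Dg v)) => u; rewrite inE => Uu.
by rewrite deriveD//; apply: diff_derivable; [exact: df|exact: dg].
Qed.

Lemma Ck_on_sum {V : normedModType R} k (I : Type) (r : seq I) (P : pred I)
    (f : I -> 'rV[R]_n -> V) :
  (forall i, P i -> Ck_on k U (f i)) ->
  Ck_on k U (fun u => \sum_(i <- r | P i) f i u).
Proof.
move=> Cf; elim: r => [|i r IHr].
  by apply: Ck_on_ext (Ck_on_cst k 0) => u _; rewrite big_nil.
case: (boolP (P i)) => [Pi|nPi].
  by apply: Ck_on_ext (Ck_onD (Cf i Pi) IHr) => u _; rewrite big_cons Pi.
by apply: Ck_on_ext IHr => u _; rewrite big_cons (negbTE nPi).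
Qed.

Lemma Ck_on_linear {V W : normedModType R} (L : {linear V -> W}) k
    (f : 'rV[R]_n -> V) :
  continuous L -> Ck_on k U f -> Ck_on k U (L \o f).
Proof.
move=> cL; elim: k f => [|k IHk] f /=.
  by move=> cf u Uu; apply: continuous_comp; [exact: cf|exact: cL].
move=> [df Df]; split=> [u Uu|v].
  by apply: differentiable_comp; [exact: df|exact: linear_differentiable].
apply: Ck_on_ext (IHk _ (Df v)) => u; rewrite inE => Uu.
by rewrite derive_linear//; exact: df.
Qed.

Lemma Ck_onM k (f g : 'rV[R]_n -> R) :
  Ck_on k U f -> Ck_on k U g -> Ck_on k U (fun u => f u * g u).
Proof.
elim: k f g => [|k IHk] f g Cf Cg.
  by move=> u Uu; apply: continuousM; [exact: Cf|exact: Cg].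
have [[df Df] [dg Dg]] := (Cf, Cg); split=> [u Uu|v].
  by apply: differentiableM; [exact: df|exact: dg].
apply: Ck_on_ext (Ck_onD (IHk _ _ (Ck_onS Cf) (Dg v))
                         (IHk _ _ (Ck_onS Cg) (Df v))) => u.
rewrite inE => Uu.
by rewrite [RHS]deriveM//; apply: diff_derivable; [exact: df|exact: dg].
Qed.

Lemma Ck_on_prod k (I : Type) (r : seq I) (f : I -> 'rV[R]_n -> R) :
  (forall i, Ck_on k U (f i)) -> Ck_on k U (fun u => \prod_(i <- r) f i u).
Proof.
move=> Cf; elim: r => [|i r IHr].
  by apply: Ck_on_ext (Ck_on_cst k (1 : R)) => u _; rewrite big_nil.
by apply: Ck_on_ext (Ck_onM (Cf i) IHr) => u _; rewrite big_cons.
Qed.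

(** The derivative -f^-1 f^-1 Df again involves the inverse, but only to order [k], where the
    induction hypothesis applies. *)
Lemma Ck_onV k (f : 'rV[R]_n -> R) :
  (forall u, U u -> f u != 0) -> Ck_on k U f -> Ck_on k U (fun u => (f u)^-1).
Proof.
move=> f0; elim: k => [|k IHk] Cf.
  by move=> u Uu; apply: continuousV; [exact: f0|exact: Cf].
have Cfi := IHk (Ck_onS Cf); case: Cf => df Df; split=> [u Uu|v].
  by apply: differentiableV; [exact: df|exact: f0].
apply: Ck_on_ext (Ck_onM (Ck_on_cst k (-1 : R)) (Ck_onM (Ck_onM Cfi Cfi) (Df v))).
move=> u; rewrite inE => Uu.
rewrite deriveV; [|exact: f0|by apply: diff_derivable; exact: df].
by rewrite /cst/= mulN1r scaleNr expr2 -invfM.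
Qed.

Lemma Ck_on_mxP k {p q} (f : 'rV[R]_n -> 'M[R]_(p, q)) :
  Ck_on k U f <-> forall i j, Ck_on k U (fun u => f u i j).
Proof.
split.
  elim: k f => [|k IHk] f.
    move=> cf i j u Uu.
    exact: (continuous_comp (cf u Uu) (@coord_continuous _ _ _ i j (f u))).
  move=> [df Df] i j; split=> [u Uu|v]; first
    exact: ((differentiable_mxP _ _).1 (df u Uu)).
  apply: Ck_on_ext (IHk _ (Df v) i j) => u; rewrite inE => Uu.
  by rewrite derive_mxE//; exact: df.
move=> Cf.
apply: (@Ck_on_ext _ k (fun u => \sum_i \sum_j f u i j *: delta_mx i j)).
  by move=> u _; rewrite -matrix_sum_delta.
apply: Ck_on_sum => i _.
apply: Ck_on_sum => j _.
have lin : linear (fun r : R => r *: (delta_mx i j : 'M[R]_(p, q))).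
  by move=> a x y; rewrite scalerDl scalerA.
pose L : {linear R -> 'M[R]_(p, q)} :=
  HB.pack (fun r : R => r *: (delta_mx i j : 'M[R]_(p, q)))
    (GRing.isLinear.Build _ _ _ _ _ lin).
apply: (@Ck_on_linear _ _ L) (Cf i j).
exact: scalel_continuous.
Qed.

Lemma Ck_on_mulmx k {m p q} (f : 'rV[R]_n -> 'M[R]_(m, p))
    (g : 'rV[R]_n -> 'M[R]_(p, q)) :
  Ck_on k U f -> Ck_on k U g -> Ck_on k U (fun u => f u *m g u).
Proof.
move=> /Ck_on_mxP Cf /Ck_on_mxP Cg; apply/Ck_on_mxP => i j.
apply: (@Ck_on_ext _ k (fun u => \sum_l f u i l * g u l j)).
  by move=> u _; rewrite mxE.
by apply: Ck_on_sum => l _; exact: Ck_onM.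
Qed.

Lemma Ck_on_det k {p} (f : 'rV[R]_n -> 'M[R]_p) :
  Ck_on k U f -> Ck_on k U (fun u => \det (f u)).
Proof.
move=> /Ck_on_mxP Cf.
apply: Ck_on_sum => s _; apply: Ck_onM; first exact: Ck_on_cst.
exact: Ck_on_prod.
Qed.

(** Cramer's formula: the entries are cofactors, polynomial in those of [f], divided by a
    nonvanishing determinant. *)
Lemma Ck_on_invmx k {p} (f : 'rV[R]_n -> 'M[R]_p) :
  (forall u, U u -> f u \in unitmx) -> Ck_on k U f ->
  Ck_on k U (fun u => invmx (f u)).
Proof.
move=> fU Cf; have /Ck_on_mxP Cfij := Cf; apply/Ck_on_mxP => i j.
have Cadj : Ck_on k U (fun u => \adj (f u) i j).
  have CM := @Ck_onM k (cst ((-1) ^+ (j + i)))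
    (fun u => \det (row' j (col' i (f u)))).
  apply: Ck_on_ext (CM (Ck_on_cst _ _) _) => [u _|]; first by rewrite mxE.
  apply: Ck_on_det; apply/Ck_on_mxP => i' j'.
  by apply: Ck_on_ext (Cfij (lift j i') (lift i j')) => u _; rewrite !mxE.
apply: (Ck_on_ext _ (Ck_onM (Ck_onV _ (Ck_on_det Cf)) Cadj)) => u; last first.
  by move=> Uu; rewrite -unitfE -unitmxE fU.
by rewrite inE => Uu; rewrite /invmx fU// [RHS]mxE.
Qed.

End Ck.


(** * Symmetry of second derivatives *)

Section Schwarz.
Context {R : realType}.

Lemma is_derive_line {V W : normedModType R} (f : V -> W) (p v : V) (s : R) :
  differentiable f (p + s *: v) ->
  is_derive s 1 (fun r : R => f (p + r *: v)) ('D_v f (p + s *: v)).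
Proof.
move=> df; pose l : R -> V := cst p + ( *:%R^~ v).
have dl : is_diff s l ( *:%R^~ v).
  by apply: (is_diff_eq (is_diffD _ _)); rewrite add0r.
have dfl : differentiable f (l s) by exact: df.
have dcomp : differentiable (f \o l) s by exact: differentiable_comp.
have -> : (fun r : R => f (p + r *: v)) = f \o l by [].
apply: DeriveDef; first exact: diff_derivable.
by rewrite deriveE// diff_comp// diff_val/= scale1r deriveE.
Qed.

(** The mean value theorem is used twice: on f(u + tw + sv) - f(u + sv) as a function of s, then on
    ['D_v f] along w at the value of s so found. The last hypothesis keeps the whole parallelogram
    inside [U]. *)
Lemma second_difference {n} (U : set 'rV[R]_n) (f : 'rV[R]_n -> R)
    (u v w : 'rV[R]_n) (t : R) :
  0 < t -> Ck_on 2 U f ->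
  (forall s r : R, 0 <= s <= t -> 0 <= r <= t -> U (u + s *: v + r *: w)) ->
  exists s r : R, [/\ 0 <= s <= t, 0 <= r <= t &
    f (u + t *: v + t *: w) - f (u + t *: v) - (f (u + t *: w) - f u) =
    'D_w ('D_v f) (u + s *: v + r *: w) * t * t].
Proof.
move=> t0 [df Df] Ubox.
have tt : 0 <= t <= t by rewrite lexx ltW.
have z0 : 0 <= (0 : R) <= t by rewrite lexx ltW.
pose phi (s : R) : R := f (u + t *: w + s *: v) - f (u + s *: v).
pose phi' (s : R) : R := 'D_v f (u + t *: w + s *: v) - 'D_v f (u + s *: v).
have dphi s : 0 <= s <= t -> is_derive s 1 phi (phi' s).
  move=> st; apply: is_deriveB; apply: is_derive_line; apply: df.
    by rewrite addrAC; exact: Ubox.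
  by have := Ubox _ _ st z0; rewrite scale0r addr0.
have cphi : {within `[0, t], continuous phi}.
  apply: derivable_within_continuous => s; rewrite in_itv/= => st.
  by have := dphi s st.
have [|c ct] := MVT (df := phi') t0 _ cphi.
  by move=> s; rewrite in_itv/= => /andP[s0 st]; apply: dphi; rewrite !ltW.
have {}ct : 0 <= c <= t.
  by move: ct; rewrite in_itv/= => /andP[? ?]; rewrite !ltW.
rewrite subr0 => phiE.
pose psi (r : R) : R := 'D_v f (u + c *: v + r *: w).
pose psi' (r : R) : R := 'D_w ('D_v f) (u + c *: v + r *: w).
have dpsi r : 0 <= r <= t -> is_derive r 1 psi (psi' r).
  by move=> rt; apply: is_derive_line; have [dDf _] := Df v; apply/dDf/Ubox.
have cpsi : {within `[0, t], continuous psi}.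
  apply: derivable_within_continuous => r; rewrite in_itv/= => rt.
  by have := dpsi r rt.
have [|d dt] := MVT (df := psi') t0 _ cpsi.
  by move=> r; rewrite in_itv/= => /andP[r0 rt]; apply: dpsi; rewrite !ltW.
have {}dt : 0 <= d <= t.
  by move: dt; rewrite in_itv/= => /andP[? ?]; rewrite !ltW.
rewrite subr0 => psiE.
exists c, d; split => //; rewrite -/(psi' d) -psiE.
move: phiE; rewrite /phi /phi' /psi !scale0r !addr0 => phiE.
rewrite (addrAC u (t *: v)) phiE; congr (_ * _).
by rewrite (addrAC u (t *: w)).
Qed.

Lemma derive_swap {n} (U : set 'rV[R]_n) (f : 'rV[R]_n -> R) (u v w : 'rV[R]_n) :
  open U -> Ck_on 2 U f -> U u -> 'D_w ('D_v f) u = 'D_v ('D_w f) u.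
Proof.
move=> openU Cf Uu; have [df Df] := Cf.
apply/eqP; rewrite -subr_eq0 -normr_le0; apply/ler_addgt0Pl => e e0.
rewrite addr0 -[e](@divfK _ 2)// mulr_natr mulr2n.
have e2 : 0 < e / 2 by rewrite divr_gt0.
have close (a b x y : R) : x = y -> `|a - x| < e / 2 -> `|b - y| < e / 2 ->
    `|a - b| <= e / 2 + e / 2.
  move=> -> ax yb; rewrite -(subrKA y); apply: le_trans (ler_normD _ _) _.
  by rewrite [`|y - b|]distrC lerD// ltW.
have [_ /(_ w) cvw] := Df v; have [_ /(_ v) cwv] := Df w.
have near_u (g h : 'rV[R]_n -> R) :
    {for u, continuous g} -> {for u, continuous h} ->
    exists2 d, 0 < d & forall x, ball u d x ->
      [/\ U x, `|g u - g x| < e / 2 & `|h u - h x| < e / 2].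
  move=> /cvgrPdist_lt /(_ _ e2) cg /cvgrPdist_lt /(_ _ e2) ch.
  have /nbhs_ballP[d d0 ball_d] : \forall x \near u,
      [/\ U x, `|g u - g x| < e / 2 & `|h u - h x| < e / 2].
    near=> x; split; [|by near: x|by near: x].
    by near: x; exact: open_nbhs_nbhs.
  by exists d.
have [d d0 ball_d] := near_u _ _ (cvw u Uu) (cwv u Uu).
(* Small enough for the parallelogram on t v and t w to fit in the ball of radius [d]; the summand 1
   keeps the denominator positive when v = w = 0. *)
pose t := d / (2 * (`|v| + `|w| + 1)).
have vw0 : 0 < `|v| + `|w| + 1 by rewrite ltr_wpDl// addr_ge0.
have t0 : 0 < t by rewrite divr_gt0// mulr_gt0.
have box (a b : 'rV[R]_n) (s r : R) : `|a| + `|b| = `|v| + `|w| ->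
    0 <= s <= t -> 0 <= r <= t -> ball u d (u + s *: a + r *: b).
  move=> ab /andP[s0 st] /andP[r0 rt].
  rewrite -ball_normE /ball_/= -addrA opprD addrA subrr add0r normrN.
  apply: le_lt_trans (ler_normD _ _) _; rewrite !normrZ !ger0_norm//.
  apply: (@le_lt_trans _ _ (t * (`|a| + `|b|))).
    by rewrite mulrDr lerD// ler_wpM2r.
  rewrite ab /t -mulrA gtr_pMr// mulrC ltr_pdivrMr ?mulr_gt0//.
  by have := addr_ge0 (normr_ge0 v) (normr_ge0 w); lra.
have [s r st rt|s [r [st rt E1]]] := @second_difference _ U f u v w t t0 Cf.
  by have [] := ball_d _ (box v w s r erefl st rt).
have [s' r' st' rt'|s' [r' [st' rt' E2]]] :=
  @second_difference _ U f u w v t t0 Cf.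
  by have [] := ball_d _ (box w v s' r' (addrC _ _) st' rt').
have [_ near1 _] := ball_d _ (box v w s r erefl st rt).
have [_ _ near2] := ball_d _ (box w v s' r' (addrC _ _) st' rt').
(* The second difference is symmetric in v and w, so both mixed derivatives, each at its own
   intermediate point, equal it after cancelling t twice. *)
have E : 'D_w ('D_v f) (u + s *: v + r *: w) =
    'D_v ('D_w f) (u + s' *: w + r' *: v).
  apply: (mulIf (lt0r_neq0 t0)); apply: (mulIf (lt0r_neq0 t0)).
  have swap (a b c x : R) : a - b - (c - x) = a - c - (b - x) by ring.
  apply: (etrans (esym E1)); apply: etrans E2.
  by rewrite (addrAC u (t *: w) (t *: v)); exact: swap.
exact: close E near1 near2.
Unshelve. all: by end_near. Qed.

Lemma derive_mx_swap {n p q} (U : set 'rV[R]_n) (f : 'rV[R]_n -> 'M[R]_(p, q))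
    (u v w : 'rV[R]_n) :
  open U -> Ck_on 2 U f -> U u -> 'D_w ('D_v f) u = 'D_v ('D_w f) u.
Proof.
move=> openU Cf Uu; have [df Df] := Cf.
have dDf a x : U x -> differentiable ('D_a f) x by have [d _] := Df a; exact: d.
have DD a b i j :
    ('D_b ('D_a f) u) i j = 'D_b ('D_a (fun x => f x i j)) u.
  rewrite derive_mxE; last exact: dDf.
  apply: near_eq_derive; apply: (near_eq_on openU _ Uu) => x; rewrite inE => Ux.
  by rewrite derive_mxE//; exact: df.
apply/matrixP => i j; apply: (etrans (DD v w i j)).
apply: etrans (esym (DD w v i j)).
exact: derive_swap openU ((Ck_on_mxP openU _ _).1 Cf i j) Uu.
Qed.

End Schwarz.

(** * The tangent space of a slant immersion at a point *)

Section LinearAlgebra.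
Context {R : realType}.

Lemma dot_ge0 m (v : 'rV[R]_m) : 0 <= dot v v.
Proof. by rewrite /dot mxE sumr_ge0// => i _; rewrite mxE -expr2 sqr_ge0. Qed.

Lemma dot_eq0 m (v : 'rV[R]_m) : (dot v v == 0) = (v == 0).
Proof.
apply/eqP/eqP => [|->]; last by rewrite /dot mul0mx mxE.
rewrite /dot mxE => /psumr_eq0P v0; apply/rowP => i; rewrite mxE.
apply/eqP; rewrite -sqrf_eq0 expr2; apply/eqP.
by have := v0 _ i isT; rewrite !mxE; apply => j _; rewrite mxE -expr2 sqr_ge0.
Qed.

Lemma row_form {m p n q} (A : 'M[R]_(m, n)) (S : 'M[R]_(n, q)) (B : 'M[R]_(p, q))
    i j : (row i A *m S *m (row j B)^T) 0 0 = (A *m S *m B^T) i j.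
Proof.
rewrite -row_mul [LHS]mxE [RHS]mxE; apply: eq_bigr => k _.
by congr (_ * _); rewrite !mxE.
Qed.

(** Polarization. It turns the slant condition, which concerns lengths only, into an identity
    between Gram matrices. *)
Lemma quadratic_form_eq0 n (S : 'M[R]_n) :
  S^T = S -> (forall x : 'rV_n, (x *m S *m x^T) 0 0 = 0) -> S = 0.
Proof.
move=> symS S0; pose b (x y : 'rV[R]_n) := (x *m S *m y^T) 0 0.
have bC x y : b x y = b y x.
  rewrite /b (_ : x *m S *m y^T = (y *m S *m x^T)^T) 1?mxE//.
  by rewrite !trmx_mul trmxK symS mulmxA.
have bD x y : b (x + y) (x + y) = b x x + b x y + (b y x + b y y).
  by rewrite /b linearD/= mulmxDl mulmxDr !mulmxDl !mxE addrACA !addrA.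
have b0 x y : b x y = 0.
  have := bD x y; rewrite /b !S0 add0r addr0 -!/(b _ _) [b y x]bC.
  by move=> /esym/eqP; rewrite -mulr2n mulrn_eq0/= => /eqP.
apply/matrixP => i j; have := b0 (delta_mx 0 i) (delta_mx 0 j).
by rewrite /b trmx_delta -rowE -colE !mxE.
Qed.

(** Gram-Schmidt as a block induction: clear the first row and column, normalize the pivot by its
    square root, and recurse on the Schur complement. *)
Lemma posdef_orthonormalize n (S : 'M[R]_n) :
  S^T = S -> (forall x : 'rV_n, x != 0 -> 0 < (x *m S *m x^T) 0 0) ->
  exists E : 'M[R]_n, E *m S *m E^T = 1%:M.
Proof.
elim: n S => [|n IHn]; first by exists 0; apply/matrixP => -[].
rewrite -[n.+1]/(1 + n)%N => S symS posS.
pose a := S 0 0; pose b : 'rV[R]_n := ursubmx S.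
pose D := drsubmx S : 'M[R]_n.
have SE : S = block_mx a%:M b b^T D.
  rewrite -[LHS]submxK; congr block_mx; last by rewrite /b trmx_ursub symS.
  by rewrite [LHS]mx11_scalar !mxE; congr (S _ _)%:M; apply/val_inj.
have symD : D^T = D by rewrite /D trmx_drsub symS.
have a0 : 0 < a.
  have := posS (row_mx 1%:M 0).
  rewrite SE mul_row_block tr_row_mx mul_row_col trmx0 mulmx0 addr0.
  rewrite trmx1 mulmx1 mul1mx mul0mx addr0 mxE eqxx; apply.
  apply/eqP => /(congr1 lsubmx); rewrite row_mxKl linear0 => /matrixP/(_ 0 0).
  by rewrite !mxE => /eqP; rewrite oner_eq0.
pose L : 'M[R]_(1 + n) := block_mx 1%:M 0 (- (a^-1 *: b^T)) 1%:M.
pose D' := D - a^-1 *: (b^T *m b).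
have LSL : L *m S *m L^T = block_mx a%:M 0 0 D'.
  rewrite SE /L mulmx_block tr_block_mx mulmx_block !trmx0 !trmx1.
  rewrite !(mul1mx, mulmx1, mul0mx, mulmx0, addr0, add0r) linearN linearZ/= trmxK.
  rewrite !mulmxN !mulNmx -!scalemxAl -!scalemxAr mul_mx_scalar mul_scalar_mx.
  rewrite !scalerA mulVf ?lt0r_neq0// !scale1r !addNr mul0mx scaler0 oppr0 add0r.
  by rewrite addrC.
have [||E EDE] := IHn D'.
- by rewrite /D' linearB linearZ/= trmx_mul trmxK symD.
(* The Schur complement is positive definite because its value at y is that of [S] at the nonzero
   vector (0, y) L. *)
- move=> y y0; have x0 : row_mx 0 y *m L != 0.
    rewrite mul_row_block mul0mx mulmx1 mulmx0 !add0r.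
    by apply: contra y0 => /eqP/(congr1 rsubmx); rewrite row_mxKr linear0 => ->.
  have := posS _ x0.
  rewrite trmx_mul mulmxA -(mulmxA _ L) -(mulmxA _ (L *m S)) LSL.
  rewrite mul_row_block tr_row_mx mul_row_col trmx0 mulmx0 add0r.
  by rewrite mul0mx !add0r.
exists (block_mx (Num.sqrt a)^-1%:M 0 0 E *m L).
rewrite trmx_mul !mulmxA -(mulmxA _ L) -(mulmxA _ (L *m S)) LSL.
rewrite tr_block_mx !trmx0 !mulmx_block !mulmx0 !mul0mx !addr0 !add0r EDE.
rewrite tr_scalar_mx -!scalar_mxM.
rewrite mulrAC -expr2 exprVn sqr_sqrtr ?ltW// mulVf ?lt0r_neq0//.
by rewrite !mul0mx; apply/esym/scalar_mx_block.
Qed.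

Definition complex_mx n : 'M[R]_(n + n) := block_mx 0 1%:M (- 1%:M) 0.

Local Notation J := (complex_mx _).

Lemma JcE n (v : 'rV[R]_(n + n)) : Jc v = v *m complex_mx n.
Proof.
rewrite /Jc -{3}[v]hsubmxK mul_row_block !mulmx0 !mulmx1 mulmxN mulmx1.
by rewrite add0r addr0.
Qed.

Lemma tr_complex_mx n : (complex_mx n)^T = - complex_mx n.
Proof.
by rewrite /complex_mx tr_block_mx linearN/= !trmx0 trmx1 opp_block_mx !oppr0 opprK.
Qed.

Lemma complex_mx_sqr n : complex_mx n *m complex_mx n = - 1%:M.
Proof.
rewrite /complex_mx mulmx_block !mulmx0 !mul0mx !mulmx1 mul1mx !add0r addr0.
by rewrite [in RHS]scalar_mx_block opp_block_mx !oppr0.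
Qed.

Lemma dot_Jc n (v : 'rV[R]_(n + n)) : dot (Jc v) (Jc v) = dot v v.
Proof.
rewrite /dot JcE trmx_mul tr_complex_mx mulmxA -(mulmxA v) mulmxN.
by rewrite complex_mx_sqr opprK mulmx1.
Qed.

Section TangentSpace.
Context {n : nat}.
Variable T : 'M[R]_(n, n + n).

Definition gram := T *m T^T.
Definition normal_proj : 'M[R]_(n + n) := 1%:M - T^T *m invmx gram *m T.
(* Row k is F(T_k). *)
Definition norF_mx := T *m J *m normal_proj.
(* Invertible iff the rows of [T], as vectors of C^n, are a C-basis. *)
Definition complex_frame : 'M[R]_(n + n) := col_mx T (T *m J).

Lemma tr_gram : gram^T = gram.
Proof. by rewrite /gram trmx_mul trmxK. Qed.

Lemma tr_normal_proj : normal_proj^T = normal_proj.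
Proof.
by rewrite /normal_proj linearB/= trmx1 !trmx_mul trmxK trmx_inv tr_gram mulmxA.
Qed.

Hypothesis freeT : row_free T.

Lemma gram_gt0 (x : 'rV[R]_n) : x != 0 -> 0 < (x *m gram *m x^T) 0 0.
Proof.
move=> x0; rewrite /gram mulmxA -mulmxA -trmx_mul -/(dot _ _).
rewrite lt_neqAle dot_ge0 andbT eq_sym dot_eq0.
by rewrite -(mul0mx _ T); apply: contra x0 => /eqP/(row_free_inj freeT) ->.
Qed.

Lemma gram_unit : gram \in unitmx.
Proof.
rewrite -row_free_unit; apply/inj_row_free => x xg0; apply/eqP.
by apply: contraPT (ltxx (0 : R)) => /gram_gt0; rewrite xg0 mul0mx mxE => ->.
Qed.

Lemma mul_normal_proj : T *m normal_proj = 0.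
Proof.
by rewrite mulmxBr mulmx1 !mulmxA -/gram mulmxV ?gram_unit// mul1mx subrr.
Qed.

Lemma normal_proj_tr : normal_proj *m T^T = 0.
Proof. by rewrite -tr_normal_proj -trmx_mul mul_normal_proj trmx0. Qed.

Lemma normal_proj_idem : normal_proj *m normal_proj = normal_proj.
Proof.
rewrite {1}/normal_proj mulmxBl mul1mx -[_ *m T *m _]mulmxA mul_normal_proj.
by rewrite mulmx0 subr0.
Qed.

(** The two pieces of [v] lie in the row space of [T] and in the kernel of T^T, which meet only in 0
    because [gram] is invertible; hence the abstract [proj_mx] has this closed form. *)
Lemma oprojE (v : 'rV[R]_(n + n)) : oproj T v = v - v *m normal_proj.
Proof.
have subT : (v - v *m normal_proj <= T)%MS.
  rewrite /normal_proj mulmxBr mulmx1 subKr !mulmxA.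
  exact: submxMl.
have subK : (v *m normal_proj <= kermx T^T)%MS.
  by apply/sub_kermxP; rewrite -mulmxA normal_proj_tr mulmx0.
have capTK : (<<T>> :&: kermx T^T)%MS = 0.
  apply/eqP; rewrite -submx0; apply/rV_subP => w; rewrite sub_capmx genmxE.
  case/andP => /submxP[x ->] /sub_kermxP.
  rewrite -mulmxA -/gram => xg; suff -> : x = 0 by rewrite mul0mx sub0mx.
  by rewrite -[x](mulmxK gram_unit) xg mul0mx.
rewrite /oproj -{1}[v](subrK (v *m normal_proj)) mulmxDl.
by rewrite proj_mx_id ?genmxE// proj_mx_0// addr0.
Qed.

Lemma norF_rowE (x : 'rV[R]_n) : norF T (x *m T) = x *m norF_mx.
Proof. by rewrite /norF /tanP oprojE subKr JcE !mulmxA. Qed.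

Lemma tr_norF_mx : norF_mx^T = normal_proj *m (T *m J)^T.
Proof. by rewrite trmx_mul tr_normal_proj. Qed.

(** The rows of [norF_mx] are already normal, so pairing with them does not see the tangential part
    of [v]: the second fundamental form may be replaced by the plain second derivative. *)
Lemma dot_sub_oproj (v : 'rV[R]_(n + n)) (x : 'rV[R]_n) :
  dot (v - oproj T v) (x *m norF_mx) = (v *m norF_mx^T *m x^T) 0 0.
Proof.
rewrite oprojE subKr /dot trmx_mul tr_norF_mx !mulmxA.
by rewrite -(mulmxA v) normal_proj_idem.
Qed.

Lemma exists_orthonormal_rows : exists E : 'M[R]_n, (E *m T) *m (E *m T)^T = 1%:M.
Proof.
have [E EgE] := posdef_orthonormalize tr_gram gram_gt0.
by exists E; rewrite trmx_mul mulmxA -(mulmxA E T).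
Qed.

Lemma orthonormal_rows_tr (E : 'M[R]_n) :
  (E *m T) *m (E *m T)^T = 1%:M -> E^T *m E = invmx gram.
Proof.
rewrite trmx_mul mulmxA -(mulmxA E T) -/gram -mulmxA => EgE.
have gEE : gram *m E^T *m E = 1%:M by exact: mulmx1C.
by rewrite -[LHS](mulKmx gram_unit) (mulmxA gram) gEE mulmx1.
Qed.

Lemma dot_oproj (v : 'rV[R]_(n + n)) :
  dot (oproj T v) (oproj T v) = dot v v - dot (v *m normal_proj) (v *m normal_proj).
Proof.
have sub00 (A B : 'M[R]_1) : (A - B) 0 0 = A 0 0 - B 0 0 by rewrite !mxE.
have trv : (v - v *m normal_proj)^T = v^T - normal_proj *m v^T.
  by rewrite linearB/= trmx_mul tr_normal_proj.
rewrite oprojE /dot trv mulmxBr !(mulmxBl v) trmx_mul tr_normal_proj.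
rewrite !mulmxA -(mulmxA v normal_proj normal_proj) normal_proj_idem.
by rewrite subrr subr0 sub00.
Qed.

(** [cos] undoes [acos] only on [-1, 1], so the ratio of norms must first be bounded by 1, which is
    Pythagoras ([dot_oproj]). If the sine vanishes, the ratio is 1 and the angle is [acos 1 = 0];
    this is how a nonzero angle yields a nonzero sine. *)
Lemma angle_subspace_cos (v : 'rV[R]_(n + n)) (a : R) :
  v != 0 -> angle_subspace v T = a ->
  [/\ dot (oproj T v) (oproj T v) = cos a ^+ 2 * dot v v & sin a = 0 -> a = 0].
Proof.
move=> v0 <-; rewrite /angle_subspace; set r := _ / _.
have dv : 0 < dot v v by rewrite lt_neqAle dot_ge0 andbT eq_sym dot_eq0.
have nv : enorm v != 0 by rewrite sqrtr_eq0 -ltNge.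
have r0 : 0 <= r by rewrite divr_ge0// sqrtr_ge0.
have r2 : r ^+ 2 * dot v v = dot (oproj T v) (oproj T v).
  by rewrite exprMn exprVn !sqr_sqrtr ?dot_ge0// divfK// gt_eqF.
have r1 : r <= 1.
  rewrite -(@expr_le1 _ 2)// -(ler_pM2r dv) r2 mul1r dot_oproj.
  by rewrite lerBlDr lerDl dot_ge0.
have rN1 : -1 <= r by apply: le_trans r0; rewrite lerN10.
split; first by rewrite acosK ?in_itv/= ?rN1.
rewrite sin_acos ?rN1// => /eqP; rewrite sqrtr_eq0 subr_le0 => r2_ge1.
suff -> : r = 1 by rewrite acos1.
by apply/eqP; rewrite eq_le r1/= -(@expr_ge1 _ 2).
Qed.

(** J is an isometry, so |FX|^2 = |X|^2 - |PX|^2 = (1 - k) |X|^2; polarization does the rest. *)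
Lemma norF_mx_gram (k : R) :
  (forall x : 'rV[R]_n,
    dot (oproj T (Jc (x *m T))) (oproj T (Jc (x *m T))) = k * dot (x *m T) (x *m T)) ->
  norF_mx *m norF_mx^T = (1 - k) *: gram.
Proof.
move=> slantT; apply/eqP; rewrite -subr_eq0; apply/eqP/quadratic_form_eq0.
  by rewrite linearB linearZ/= tr_gram trmx_mul trmxK.
have sub00 (A B : 'M[R]_1) : (A - B) 0 0 = A 0 0 - B 0 0 by rewrite !mxE.
move=> x; set v := Jc (x *m T).
have xF : (x *m (norF_mx *m norF_mx^T) *m x^T) 0 0 =
    dot (v *m normal_proj) (v *m normal_proj).
  by rewrite /dot /v /norF_mx JcE !(mulmxA, trmx_mul).
have xg : (x *m gram *m x^T) 0 0 = dot v v.
  by rewrite /v dot_Jc /dot trmx_mul /gram !mulmxA.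
have := slantT x; rewrite -/v -[dot (x *m T) _]dot_Jc -/v dot_oproj.
rewrite (mulmxBr x (norF_mx *m _)) (mulmxBl (x *m (norF_mx *m _))) sub00 xF.
have -> : (x *m ((1 - k) *: gram) *m x^T) 0 0 = (1 - k) * dot v v.
  by rewrite -scalemxAr -scalemxAl mxE xg.
lra.
Qed.

(** Projecting a relation x T + y T J = 0 onto the normal space leaves y F = 0; the Gram identity
    then kills y, and freeness of the rows of [T] kills x. *)
Lemma complex_frame_unit (k : R) :
  k != 0 -> norF_mx *m norF_mx^T = k *: gram -> complex_frame \in unitmx.
Proof.
move=> k0 Fk; rewrite -row_free_unit; apply/inj_row_free => z.
rewrite -[z]hsubmxK; move: (lsubmx z) (rsubmx z) => x y.
rewrite mul_row_col => xyT.
have y0 : y = 0.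
  have : y *m (norF_mx *m norF_mx^T) = 0.
    have := congr1 (mulmx^~ normal_proj) xyT.
    rewrite /= mulmxDl -(mulmxA x) mul_normal_proj mulmx0 add0r mul0mx => yF.
    by rewrite mulmxA /norF_mx (mulmxA y) yF mul0mx.
  rewrite Fk -scalemxAr => /eqP; rewrite scaler_eq0 (negbTE k0)/= => /eqP yg.
  by rewrite -[y](mulmxK gram_unit) yg mul0mx.
have x0 : x = 0.
  by apply: (row_free_inj freeT); rewrite mul0mx -xyT y0 mul0mx addr0.
by rewrite x0 y0 row_mx0.
Qed.

Lemma mxtrace_norF_mx (k : R) (X : 'M[R]_(n, n + n)) :
  complex_frame \in unitmx -> norF_mx *m norF_mx^T = k *: gram ->
  \tr (X *m norF_mx^T *m invmx gram) = k * \tr (rsubmx (X *m invmx complex_frame)).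
Proof.
move=> Mu Fk; rewrite -{1}[X](mulmxKV Mu).
set Y := X *m _; rewrite -{1}[Y]hsubmxK mul_row_col mulmxDl.
have -> : lsubmx Y *m T *m norF_mx^T = 0.
  by rewrite tr_norF_mx -mulmxA (mulmxA T) mul_normal_proj mul0mx mulmx0.
have -> : rsubmx Y *m (T *m J) *m norF_mx^T = rsubmx Y *m (norF_mx *m norF_mx^T).
  rewrite -mulmxA; congr (_ *m _).
  (* Pairing with the normal rows of [norF_mx] sees only the normal part of T J, which is [norF_mx]
     itself. *)
  have FQ : norF_mx *m normal_proj = norF_mx.
    by rewrite /norF_mx -mulmxA normal_proj_idem.
  by rewrite tr_norF_mx [RHS]mulmxA FQ mulmxA.
by rewrite add0r Fk -scalemxAr -scalemxAl mulmxK ?gram_unit// mxtraceZ.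
Qed.

(** The sum is the trace of E X F^T E^T; cyclicity brings E and its transpose together as E^T E =
    g^-1, and the right-hand side no longer mentions [E]. *)
Lemma sum_orthonormal_rows (k : R) (E : 'M[R]_n) (X : 'M[R]_(n, n + n)) :
  complex_frame \in unitmx -> norF_mx *m norF_mx^T = k *: gram ->
  (E *m T) *m (E *m T)^T = 1%:M ->
  \sum_i (row i E *m X *m norF_mx^T *m (row i E)^T) 0 0 =
  k * \tr (rsubmx (X *m invmx complex_frame)).
Proof.
move=> Mu Fk ET; rewrite -mxtrace_norF_mx// -(orthonormal_rows_tr ET).
rewrite mulmxA mxtrace_mulC !mulmxA; apply: eq_bigr => i _.
by rewrite -(mulmxA _ X) row_form !mulmxA.
Qed.

End TangentSpace.

End LinearAlgebra.

(** * The differential of the complex determinant *)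

Section FrameTraces.
Context {R : realType} {n : nat}.
Implicit Types T X Y : 'M[R]_(n, n + n).

Lemma mul_inv_frame T : complex_frame T \in unitmx ->
  T *m invmx (complex_frame T) = row_mx 1%:M 0.
Proof.
move=> Mu; rewrite -[RHS](mulmxK Mu); congr (_ *m _).
by rewrite mul_row_col mul1mx mul0mx addr0.
Qed.

Lemma complex_frame_is_linear : linear (@complex_frame R n).
Proof.
by move=> k X Y; rewrite /complex_frame mulmxDl -scalemxAl scale_col_mx add_col_mx.
Qed.

(* With [X *m M^-1 = [A B]] and [Y *m M^-1 = [C D]], multiplication by i gives
   [Y *m J *m M^-1 = [-D C]], so that the trace is [\tr (A D + B C)]. *)
Lemma mxtrace_frame_sym T X Y : complex_frame T \in unitmx ->
  let M := complex_frame T in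
  \tr (rsubmx (X *m invmx M *m (complex_frame Y *m invmx M))) =
  \tr (rsubmx (Y *m invmx M *m (complex_frame X *m invmx M))).
Proof.
move=> Mu M.
have frameE Z : complex_frame Z *m invmx M =
    block_mx (lsubmx (Z *m invmx M)) (rsubmx (Z *m invmx M))
             (- rsubmx (Z *m invmx M)) (lsubmx (Z *m invmx M)).
  set A := lsubmx _; set B := rsubmx _.
  rewrite -[RHS](mulmxK Mu); congr (_ *m _).
  have ZE : Z = A *m T + B *m (T *m complex_mx n).
    by rewrite -mul_row_col hsubmxK mulmxKV.
  rewrite /M /complex_frame mul_block_col -ZE; congr col_mx.
  rewrite {1}ZE mulmxDl -!mulmxA complex_mx_sqr !mulmxN mulmx1 mulNmx.
  by rewrite addrC !mulmxA.
have prodE (A B : 'M[R]_(n, n + n)) :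
    rsubmx (A *m block_mx (lsubmx B) (rsubmx B) (- rsubmx B) (lsubmx B)) =
    lsubmx A *m rsubmx B + rsubmx A *m lsubmx B.
  by rewrite -{1}[A]hsubmxK mul_row_block row_mxKr.
rewrite !frameE !prodE !mxtraceD [LHS]addrC.
by congr (_ + _); rewrite mxtrace_mulC.
Qed.

(** This is the derivative of a product K T with K real, W standing for the derivative of K. The
    term W T has real coefficients and so no right half, while K X contributes a conjugate by K, of
    the same trace. *)
Lemma mxtrace_frame_pullback (K W : 'M[R]_n) T X :
  K \in unitmx -> complex_frame T \in unitmx ->
  \tr (rsubmx ((W *m T + K *m X) *m invmx (complex_frame (K *m T)))) =
  \tr (rsubmx (X *m invmx (complex_frame T))).
Proof.
move=> Ku Mu; set M := complex_frame T.
pose K2 := block_mx K 0 0 K; pose K2i := block_mx (invmx K) 0 0 (invmx K).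
have K2K : K2 *m K2i = 1%:M.
  rewrite mulmx_block !mulmx0 !mul0mx !addr0 add0r mulmxV//.
  by apply/esym/scalar_mx_block.
have [K2u K2iu] := mulmx1_unit K2K.
have -> : complex_frame (K *m T) = K2 *m M.
  by rewrite /M /complex_frame mul_block_col !mul0mx addr0 add0r mulmxA.
have -> : invmx (K2 *m M) = invmx M *m K2i.
  apply: (@row_full_inj _ _ _ _ (K2 *m M)).
    by rewrite row_full_unit unitmx_mul K2u.
  rewrite mulmxV ?unitmx_mul ?K2u//.
  by rewrite -mulmxA (mulmxA M) mulmxV// mul1mx K2K.
rewrite mulmxA mulmxDl -(mulmxA W) mul_inv_frame// mulmxDl linearD/= mxtraceD.
rewrite -mulmxA mul_row_block !mul0mx !mulmx0 !addr0 mul_mx_row mulmx0 row_mxKr.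
rewrite mxtrace0 add0r -2!(mulmxA K) -[X *m _]hsubmxK mul_row_block.
rewrite !mulmx0 addr0 add0r mul_mx_row !row_mxKr.
by rewrite mxtrace_mulC -mulmxA mulVmx// mulmx1.
Qed.

End FrameTraces.

(** * Jacobians, the chain rule and the derivative of an inverse *)

Section Jacobian.
Context {R : realType}.

Lemma jacobianE {m n} (f : 'rV[R]_m -> 'rV[R]_n) u i j :
  differentiable f u -> jacobian f u i j = ('D_(delta_mx 0 i) f u) 0 j.
Proof. by move=> df; rewrite deriveEjacobian// -rowE [RHS]mxE. Qed.

Lemma eq_mulmxl {m n} (A B : 'M[R]_(m, n)) :
  (forall x : 'rV[R]_m, x *m A = x *m B) -> A = B.
Proof. by move=> AB; apply/row_matrixP => i; rewrite !rowE AB. Qed.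

Lemma near_eq_jacobian {m n} (f g : 'rV[R]_m -> 'rV[R]_n) u :
  (\near u, f u = g u) -> differentiable f u -> jacobian f u = jacobian g u.
Proof.
move=> fg df; have dg := near_eq_differentiable fg df.
apply: eq_mulmxl => x.
apply: (etrans (esym (deriveEjacobian x df))).
by apply: etrans (deriveEjacobian x dg); exact: near_eq_derive.
Qed.

Lemma derive_comp {m n} {W : normedModType R} (f : 'rV[R]_m -> 'rV[R]_n)
    (g : 'rV[R]_n -> W) u (x : 'rV[R]_m) :
  differentiable f u -> differentiable g (f u) ->
  'D_x (g \o f) u = 'D_(x *m jacobian f u) g (f u).
Proof.
move=> df dg; rewrite -(deriveEjacobian x df).
apply: (etrans (deriveE x (differentiable_comp df dg))).
by rewrite diff_comp//= (deriveE x df) (deriveE _ dg).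
Qed.

Lemma jacobian_comp {m n p} (f : 'rV[R]_m -> 'rV[R]_n) (g : 'rV[R]_n -> 'rV[R]_p) u :
  differentiable f u -> differentiable g (f u) ->
  jacobian (g \o f) u = jacobian f u *m jacobian g (f u).
Proof.
move=> df dg; apply: eq_mulmxl => x.
apply: (etrans (esym (deriveEjacobian x (differentiable_comp df dg)))).
by rewrite derive_comp// deriveEjacobian// mulmxA.
Qed.

Lemma Ck_on_jacobian {m n} k (U : set 'rV[R]_m) (f : 'rV[R]_m -> 'rV[R]_n) :
  open U -> Ck_on k.+1 U f -> Ck_on k U (jacobian f).
Proof.
move=> openU [df Df]; apply/(Ck_on_mxP openU) => i j.
have := (Ck_on_mxP openU k _).1 (Df (delta_mx 0 i)) 0 j.
apply: (Ck_on_ext openU) => u; rewrite inE => Uu.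
by rewrite jacobianE//; exact: df.
Qed.

(** Differentiate f^-1 f = 1 and solve. Differentiability of the inverse is supplied separately,
    through [Ck_on_invmx]. *)
Lemma derive_invmx {V : normedModType R} {p} (f : V -> 'M[R]_p) u (v : V) :
  (\forall x \near u, f x \in unitmx) -> differentiable f u ->
  differentiable (fun x => invmx (f x)) u ->
  'D_v (fun x => invmx (f x)) u =
  - (invmx (f u) *m 'D_v f u *m invmx (f u)).
Proof.
move=> fU df di.
have D1 : 'D_v (fun x => invmx (f x) *m f x) u = 0.
  rewrite -[RHS](@derive_cst _ _ _ (1%:M : 'M[R]_p) u v).
  by apply: near_eq_derive; apply: filterS fU => x fx; rewrite mulVmx.
have fu : f u \in unitmx by exact: nbhs_singleton fU.
have := D1; rewrite derive_mulmx// => /eqP; rewrite addr_eq0 => /eqP Di.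
by rewrite -[LHS](mulmxK fu) Di mulNmx.
Qed.

End Jacobian.

(** * The differential of the argument of the complex determinant in one chart *)

Section LocalForm.
Context {R : realType} {n : nat}.
Implicit Types (F : 'rV[R]_n -> 'rV[R]_(n + n)) (U : set 'rV[R]_n).

(* With [D_x T_k = sum_l (a_kl T_l + b_kl J T_l)], this is [sum_k b_kk], the
   imaginary part of the logarithmic derivative of the complex determinant. *)
Definition local_form F (u x : 'rV[R]_n) : R :=
  \tr (rsubmx ('D_x (jacobian F) u *m invmx (complex_frame (jacobian F u)))).

(** Named so that it can carry a linear structure, through which derivatives and smoothness pass. *)
Definition trace_rsub (X : 'M[R]_(n, n + n)) : R := \tr (rsubmx X).

Lemma trace_rsub_is_linear : linear trace_rsub.
Proof. by move=> k X Y; rewrite /trace_rsub linearP/= mxtraceD mxtraceZ. Qed.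

HB.instance Definition _ :=
  GRing.isLinear.Build R 'M[R]_(n, n + n) R _ trace_rsub trace_rsub_is_linear.
HB.instance Definition _ := GRing.isLinear.Build R
  'M[R]_(n, n + n) 'M[R]_(n + n) _ (@complex_frame R n) complex_frame_is_linear.

Section Smooth.
Variables (U : set 'rV[R]_n) (F : 'rV[R]_n -> 'rV[R]_(n + n)).
Hypothesis openU : open U.
Hypothesis smoothF : smooth_on U F.
Hypothesis frameU : forall u, U u -> complex_frame (jacobian F u) \in unitmx.

Lemma smooth_jacobian k : Ck_on k U (jacobian F).
Proof. exact: Ck_on_jacobian. Qed.

Lemma smooth_frame k : Ck_on k U (fun u => complex_frame (jacobian F u)).
Proof.
apply: (Ck_on_linear openU (L := @complex_frame R n)).
  exact: mx_linear_continuous.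
exact: smooth_jacobian.
Qed.

Lemma smooth_inv_frame k : Ck_on k U (fun u => invmx (complex_frame (jacobian F u))).
Proof. by apply: Ck_on_invmx => //; exact: smooth_frame. Qed.

Lemma smooth_local_form k (x : 'rV[R]_n) : Ck_on k U (local_form F ^~ x).
Proof.
apply: (Ck_on_linear openU (L := trace_rsub)); first exact: mx_linear_continuous.
apply: Ck_on_mulmx => //; last exact: smooth_inv_frame.
by have [_] := smooth_jacobian k.+1; exact.
Qed.

Lemma local_formE (u x : 'rV[R]_n) : U u ->
  local_form F u x = \sum_j x 0 j * local_form F u (delta_mx 0 j).
Proof.
move=> Uu; have [dJ _] := smooth_jacobian 1.
rewrite /local_form deriveE; last exact: dJ.
rewrite {1}[x]row_sum_delta linear_sum mulmx_suml -!/(trace_rsub _) linear_sum.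
apply: eq_bigr => j _; rewrite linearZ/= -scalemxAl linearZ/=.
by rewrite /local_form deriveE//; exact: dJ.
Qed.

Lemma local_form_closed (u x y : 'rV[R]_n) : U u ->
  'D_x (fun v => local_form F v y) u = 'D_y (fun v => local_form F v x) u.
Proof.
move=> Uu.
have [dJ DJ] := smooth_jacobian 2; have [dI _] := smooth_inv_frame 1.
have [dM _] := smooth_frame 1.
set T := jacobian F u; pose M := complex_frame T.
(* Product rule: the negative term comes from the inverse frame, and by linearity the derivative of
   the frame is the frame of the derivative. *)
have DE (a b : 'rV[R]_n) : 'D_a (fun v => local_form F v b) u =
    trace_rsub ('D_a ('D_b (jacobian F)) u *m invmx M) -
    trace_rsub ('D_b (jacobian F) u *m invmx M *m
                (complex_frame ('D_a (jacobian F) u) *m invmx M)).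
  have [dDJ _] := DJ b.
  rewrite (derive_linear (L := trace_rsub)
    (f := fun v => 'D_b (jacobian F) v *m invmx (complex_frame (jacobian F v)))).
  - rewrite derive_mulmx; [|exact: dDJ|exact: dI].
    rewrite derive_invmx; [|by apply: filterS (open_nbhs_nbhs (conj openU Uu))|
      exact: dM|exact: dI].
    rewrite (derive_linear (L := @complex_frame R n) (f := jacobian F)).
    + by rewrite mulmxN linearB/= !mulmxA.
    + exact: mx_linear_continuous.
    + exact: dJ.
  - exact: mx_linear_continuous.
  - by apply: differentiable_mulmx; [exact: dDJ|exact: dI].
apply: (etrans (DE x y)); apply: (etrans _ (esym (DE y x))).
apply: (f_equal2 (fun r s : R => r - s)); last first.
  exact: (mxtrace_frame_sym _ _ (frameU Uu)).
apply: (congr1 (fun A => trace_rsub (A *m invmx M))).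
exact: derive_mx_swap openU (smooth_jacobian 2) Uu.
Qed.

End Smooth.

Lemma local_form_pullback U V F G (t : 'rV[R]_n -> 'rV[R]_n) (u x : 'rV[R]_n) :
  open U -> U u -> {in U, F =1 G \o t} -> Ck_on 2 U t ->
  open V -> (forall v, U v -> V (t v)) -> Ck_on 2 V G ->
  row_free (jacobian F u) -> complex_frame (jacobian G (t u)) \in unitmx ->
  local_form F u x = local_form G (t u) (x *m jacobian t u).
Proof.
move=> openU Uu FG Ct openV tV CG freeF frameG.
have [dt _] := Ct; have [dG _] := CG.
have [dJt _] := Ck_on_jacobian openU Ct; have [dJG _] := Ck_on_jacobian openV CG.
have JF v : U v -> jacobian F v = jacobian t v *m jacobian G (t v).
  move=> Uv; rewrite -jacobian_comp; [|exact: dt|by apply/dG/tV].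
  apply/esym/near_eq_jacobian.
    by apply: filterS (near_eq_on openU FG Uv) => w ->.
  by apply: differentiable_comp; [exact: dt|apply/dG/tV].
(* No inverse transition map is called upon: a vector killed by the Jacobian of [t] is killed by
   that of [F], whose rows are free. *)
have Ku : jacobian t u \in unitmx.
  rewrite -row_free_unit; apply/inj_row_free => y yK.
  by apply: (row_free_inj freeF); rewrite JF// mulmxA yK !mul0mx.
have dJGt : differentiable (jacobian G \o t) u.
  by apply: differentiable_comp; [exact: dt|apply/dJG/tV].
have DJF : 'D_x (jacobian F) u = 'D_x (jacobian t) u *m jacobian G (t u) +
    jacobian t u *m 'D_(x *m jacobian t u) (jacobian G) (t u).
  have DP := derive_mulmx x (dJt u Uu) dJGt.
  have DG := derive_comp x (dt u Uu) (dJG (t u) (tV u Uu)).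
  apply: etrans (etrans DP (congr1 (fun A : 'M[R]_(n, n + n) =>
    'D_x (jacobian t) u *m jacobian G (t u) + jacobian t u *m A) DG)).
  apply: near_eq_derive; apply: (near_eq_on openU _ Uu) => v; rewrite inE.
  exact: JF.
apply: (etrans (f_equal2 (fun A B : 'M[R]_(n, n + n) =>
  \tr (rsubmx (A *m invmx (complex_frame B)))) DJF (JF u Uu))).
exact: mxtrace_frame_pullback.
Qed.

End LocalForm.

(** * The canonical form *)

Section SlantSubmanifold.
Context {R : realType} {n : nat} {N : smooth_manifold R n}.
Variables (phi : N -> 'rV[R]_(n + n)) (alpha : R).
Hypothesis immersion_phi : immersion phi.
Hypothesis slant_phi : slant phi alpha.
Hypothesis alpha0 : alpha != 0.

Local Notation F a := (phi \o param a).

Lemma open_crange (a : atlas N) : open (crange a).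
Proof. exact: coord_open. Qed.

Lemma open_crange_preimage (a : atlas N) (W : set N) :
  open W -> open (crange a `&` (param a @^-1` W)).
Proof.
move=> openW; rewrite openE => u [au Wu]; apply: filterI.
  by apply: open_nbhs_nbhs; split => //; exact: open_crange.
by apply: (param_continuous au); exact: open_nbhs_nbhs.
Qed.

Lemma smooth_immersion (a : atlas N) : smooth_on (crange a) (F a).
Proof. by have [/(_ a)] := immersion_phi; rewrite preimage_setT setIT. Qed.

Lemma smooth_tspace (a : atlas N) k : Ck_on k (crange a) (jacobian (F a)).
Proof.
by apply: smooth_jacobian; [exact: open_crange|exact: smooth_immersion].
Qed.

Lemma row_free_tspace (a : atlas N) u : crange a u -> row_free (jacobian (F a) u).
Proof. by have [_] := immersion_phi; exact. Qed.

(** The slant condition constrains [alpha] only through nonzero tangent vectors, so even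
    [sin alpha != 0] needs a witness [x]. *)
Lemma slant_angle (a : atlas N) u (x : 'rV[R]_n) : crange a u -> x != 0 ->
  let T := jacobian (F a) u in
  [/\ dot (oproj T (Jc (x *m T))) (oproj T (Jc (x *m T))) =
        cos alpha ^+ 2 * dot (x *m T) (x *m T) &
      sin alpha != 0].
Proof.
move=> au x0 T; have freeT : row_free T by exact: row_free_tspace.
have xT0 : x *m T != 0.
  by apply: contra x0 => /eqP; rewrite -(mul0mx _ T) => /(row_free_inj freeT) ->.
have JxT0 : Jc (x *m T) != 0 by rewrite -dot_eq0 dot_Jc dot_eq0.
have [|cosE sinE] := angle_subspace_cos freeT JxT0 (a := alpha).
  by apply: (slant_phi au) => //; exact: submxMl.
split; first by rewrite cosE dot_Jc.
by apply: contra alpha0 => /eqP/sinE ->.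
Qed.

Lemma slant_norF_gram (a : atlas N) u : crange a u ->
  norF_mx (jacobian (F a) u) *m (norF_mx (jacobian (F a) u))^T =
  sin alpha ^+ 2 *: gram (jacobian (F a) u).
Proof.
move=> au; have freeT := row_free_tspace au.
rewrite sin2cos2; apply: (norF_mx_gram freeT) => x.
have [->|x0] := eqVneq x 0; last by have [] := slant_angle au x0.
by rewrite mul0mx JcE mul0mx oprojE// mul0mx subrr /dot mul0mx mxE mulr0.
Qed.

Lemma slant_frame_unit (a : atlas N) u : crange a u ->
  complex_frame (jacobian (F a) u) \in unitmx.
Proof.
move=> au; have freeT := row_free_tspace au.
(* For n = 0 there is no nonzero tangent vector and [sin alpha] may vanish, but the frame is then
   the empty matrix. *)
have [n0|n_gt0] := posnP n.
  rewrite -row_free_unit; apply/inj_row_free => z _.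
  by apply/rowP => -[j jn]; exfalso; move: jn; rewrite n0.
have [|_ sin0] := slant_angle (x := const_mx 1) au.
  apply/eqP => /rowP/(_ (Ordinal n_gt0)); rewrite !mxE => /eqP.
  by rewrite oner_eq0.
apply: (complex_frame_unit freeT _ (slant_norF_gram au)).
by rewrite expf_neq0.
Qed.

Lemma derive_tangent (a : atlas N) u (x y : 'rV[R]_n) : crange a u ->
  'D_x (fun v => 'D_y (F a) v) u = y *m 'D_x (jacobian (F a)) u.
Proof.
move=> au; have [dF _] := smooth_immersion a 1.
have [dJ _] := smooth_tspace a 1.
pose L : {linear 'M[R]_(n, n + n) -> 'rV[R]_(n + n)} := mulmx y.
have cL : continuous L by exact: mx_linear_continuous.
apply: (etrans _ (derive_linear x cL (dJ u au))).
apply: near_eq_derive; apply: (near_eq_on (@open_crange a) _ au) => v.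
by rewrite inE => av; apply: deriveEjacobian; exact: dF.
Qed.

Lemma canonical_formE (a : atlas N) u j : crange a u ->
  canonical_form phi alpha a u j 0 =
  sin alpha * local_form (F a) u (delta_mx 0 j).
Proof.
move=> au; have freeT := row_free_tspace au.
rewrite /canonical_form mxE; set E := xget _ _.
(* The default 0 of [xget] does no harm: the Gram matrix is positive definite, so an orthonormal
   basis exists. *)
have ET : orthonormal_basis phi a u E.
  apply: (@xgetPex _ 0 [set E | orthonormal_basis phi a u E]).
  exact: exists_orthonormal_rows.
transitivity ((sin alpha)^-1 *
    (sin alpha ^+ 2 * local_form (F a) u (delta_mx 0 j))).
  congr (_ * _).
  apply: etrans (sum_orthonormal_rows freeT
    ('D_(delta_mx 0 j) (jacobian (F a)) u)
    (slant_frame_unit au) (slant_norF_gram au) ET).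
  apply: eq_bigr => i _; rewrite /second_ff derive_tangent// /tspace.
  by rewrite norF_rowE// dot_sub_oproj.
(* With the convention 0^-1 = 0 both sides vanish when the sine does, which spares a proof that it
   is nonzero. *)
have [->|s0] := eqVneq (sin alpha) 0; first by rewrite invr0 !mul0r.
by rewrite mulrA expr2 mulKf.
Qed.

Lemma ev_canonical_form (a : atlas N) u x : crange a u ->
  ev (canonical_form phi alpha) a u x = sin alpha * local_form (F a) u x.
Proof.
move=> au; rewrite /ev mxE.
rewrite (local_formE (@open_crange a) (smooth_immersion a) x au) mulr_sumr.
by apply: eq_bigr => j _; rewrite canonical_formE// mulrCA.
Qed.

Lemma smooth_canonical_form (a : atlas N) :
  smooth_on (crange a) (canonical_form phi alpha a).
Proof.
move=> k; apply/(Ck_on_mxP (@open_crange a)) => i j.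
have Cl : Ck_on k (crange a) (local_form (F a) ^~ (delta_mx 0 i)).
  apply: smooth_local_form; [exact: open_crange|exact: smooth_immersion|].
  exact: slant_frame_unit.
apply: (Ck_on_ext (@open_crange a) _
  (Ck_onM (@open_crange a) (Ck_on_cst (@open_crange a) k (sin alpha)) Cl)) => u.
by rewrite inE => au; rewrite ord1 canonical_formE.
Qed.

Lemma canonical_form_transition (a b : atlas N) u x :
  crange a u -> cdom b (param a u) ->
  ev (canonical_form phi alpha) a u x =
  ev (canonical_form phi alpha) b (Defs.coord b (param a u))
     (x *m jacobian (Defs.coord b \o param a) u).
Proof.
move=> au bu.
have bt : crange b (Defs.coord b (param a u)) by exists (param a u).
apply: (etrans (ev_canonical_form x au)).
apply: (etrans _ (esym (ev_canonical_form _ bt))).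
apply: (congr1 (fun r : R => sin alpha * r)).
apply: (@local_form_pullback _ _
  (crange a `&` (param a @^-1` cdom b)) (crange b)).
- by apply: open_crange_preimage; exact: cdom_open.
- by [].
- by move=> v; rewrite inE => -[_ bv] /=; rewrite coordK.
- exact: (transition_smooth a b 2).
- exact: open_crange.
- by move=> v [_ bv]; exists (param a v).
- exact: smooth_immersion.
- exact: row_free_tspace.
- exact: slant_frame_unit.
Qed.

Lemma canonical_form_closed (a : atlas N) u (x y : 'rV[R]_n) : crange a u ->
  ext_d (canonical_form phi alpha) a u x y = 0.
Proof.
move=> au.
have D (z w : 'rV[R]_n) :
    'D_z (fun v => ev (canonical_form phi alpha) a v w : R^o) u =
    sin alpha * 'D_z (local_form (F a) ^~ w) u.
  have [dl _] := @smooth_local_form _ _ _ (F a)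
    (@open_crange a) (smooth_immersion a)
    (fun u => @slant_frame_unit a u) 1 w.
  apply: etrans (deriveZ (sin alpha) (diff_derivable (dl u au))).
  apply: near_eq_derive; apply: (near_eq_on (@open_crange a) _ au) => v.
  by rewrite inE => av; exact: ev_canonical_form.
apply/eqP; rewrite subr_eq0; apply/eqP.
apply: (etrans (D x y)); apply: etrans (esym (D y x)).
apply: (congr1 (fun r : R => sin alpha * r)).
apply: local_form_closed au; [exact: open_crange|exact: smooth_immersion|].
exact: slant_frame_unit.
Qed.

(** The frame fields have variable coefficients in the chart, whereas [second_ff] extends vectors
    with constant ones. The discrepancy, the derivative of the coefficients times T, is tangent and
    disappears when paired with a normal vector. *)
Lemma canonical_form_frame (W : set N) (e es : 'I_n -> N -> 'rV[R]_(n + n))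
    (a : atlas N) u (x : 'rV[R]_n) :
  adapted_slant_frame phi alpha W e es -> crange a u -> W (param a u) ->
  ev (canonical_form phi alpha) a u x = \sum_i connection_form e es i i a u x.
Proof.
move=> [openW smoothe orth tangent] au Wu.
pose U := crange a `&` (param a @^-1` W).
have openU : open U by exact: open_crange_preimage.
have Uu : U u by [].
have freeT := row_free_tspace au.
pose T := jacobian (F a); pose M v := complex_frame (T v).
(* Reading the coefficients off through the inverse of the square matrix M makes them visibly
   differentiable; for a tangent vector the right half is zero. *)
pose c i v := lsubmx (e i (param a v) *m invmx (M v)).
have eE i v : U v -> e i (param a v) = c i v *m T v.
  move=> [av Wv]; have [/(_ i) /submxP[y ey] _ _] := tangent a v av Wv.
  rewrite /c ey /tspace -/(T v) -mulmxA.
  by rewrite mul_inv_frame ?slant_frame_unit// mul_mx_row row_mxKl mulmx1.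
have dc i : differentiable (c i) u.
  have [/(_ a 1%N)[de _] _] := smoothe i.
  have [dI _] := @smooth_inv_frame _ _ _ (F a)
    (@open_crange a) (smooth_immersion a)
    (fun u => @slant_frame_unit a u) 1.
  apply: differentiable_comp; last exact: differentiable_lsubmx.
  by apply: differentiable_mulmx; [exact: de|exact: dI].
have dT : differentiable T u by have [dJ _] := smooth_tspace a 1; exact: dJ.
pose E := \matrix_i c i u.
have ET : (E *m T u) *m (E *m T u)^T = 1%:M.
  have rowET i : row i (E *m T u) = e i (param a u).
    by rewrite row_mul rowK eE.
  apply/matrixP => i j; have [ee _ _] := orth _ Wu i j.
  by rewrite [RHS]mxE -ee -!rowET /dot -[row i _]mulmx1 row_form mulmx1.
rewrite ev_canonical_form//.
transitivity ((sin alpha)^-1 * (sin alpha ^+ 2 * local_form (F a) u x)).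
  have [->|s0] := eqVneq (sin alpha) 0; first by rewrite invr0 !mul0r.
  by rewrite mulrA expr2 mulKf.
rewrite /local_form -(sum_orthonormal_rows freeT _ (slant_frame_unit au)
  (slant_norF_gram au) ET) mulr_sumr.
apply: eq_bigr => i _; rewrite /connection_form.
have De : 'D_x (e i \o param a) u = 'D_x (c i) u *m T u + c i u *m 'D_x T u.
  apply: etrans (derive_mulmx x (dc i) dT).
  apply: near_eq_derive; apply: (near_eq_on openU _ Uu) => v.
  by rewrite inE; exact: eE.
have [_ _ /(_ i) ->] := tangent a u au Wu.
rewrite [e i (param a u)]eE// norF_rowE// rowK /dot linearZ/= -scalemxAr.
rewrite [RHS]mxE; congr (_ * _); rewrite (trmx_mul (c i u)) [in RHS]mulmxA.
apply: (congr1 (fun A : 'M[R]_(1, n) => (A *m (c i u)^T) 0 0)).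
apply: (etrans _ (esym (congr1 (mulmx^~ _) De))).
rewrite /= mulmxDl -(mulmxA _ (T u)) tr_norF_mx (mulmxA (T u)) mul_normal_proj//.
by rewrite mul0mx mulmx0 add0r.
Qed.

End SlantSubmanifold.

Theorem theorem3p1 (R : realType) (n : nat) (N : smooth_manifold R n)
    (phi : N -> 'rV[R]_(n + n)) (alpha : R) :
  immersion phi -> proper_slant phi alpha ->
  let Theta := canonical_form phi alpha in
  [/\ forall (W : set N) (e es : 'I_n -> N -> 'rV[R]_(n + n)),
        adapted_slant_frame phi alpha W e es ->
        forall a u xi, crange a u -> W (param a u) ->
          ev Theta a u xi = \sum_i connection_form e es i i a u xi,
      one_form Theta,
      forall a u xi eta, crange a u -> ext_d Theta a u xi eta = 0
    & H1 (cohomology_class Theta)].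
Proof.
move=> imm [sl alpha0 _] Theta.
have one : one_form Theta.
  split=> [a|a b u au bu x]; first exact: smooth_canonical_form.
  exact: canonical_form_transition.
have closed a u x y : crange a u -> ext_d Theta a u x y = 0.
  exact: canonical_form_closed.
split=> // [W e es frame a u x au Wu|].
  exact: canonical_form_frame frame au Wu.
by exists Theta => //; split=> // a u au x y; exact: closed.
Qed.
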